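(* Let $m,n$ be positive integers with $m$ odd and $m\geq 3$. Then $$\zeta^\star(\{2m\}^n)=(2\pi i)^{2mn}\sum_{\substack{p_1+\cdots+p_m=2mn\\ p_j\geq0}}\left(\prod_{j=1}^m\frac{B_{p_j}}{p_j!}\right)\exp\left(\frac{2\pi i}{m}\sum_{\ell=1}^m(\ell-1)p_\ell\right).$$
   Context: $\zeta^\star(\{2m\}^n)=\sum_{1\leq k_1\leq\cdots\leq k_n}(k_1\cdots k_n)^{-2m}$. The Bernoulli numbers $B_n$ are defined by $\frac{t}{e^t-1}=\sum_{n\geq0}B_n\frac{t^n}{n!}$ (so $B_1=-\tfrac12$). *)

(* Defs.v *)
(* MathComp / MathComp-Analysis, with complex numbers R[i] over R : realType. *)
From HB Require Import structures.
From mathcomp Require Import all_boot all_order all_algebra.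
From mathcomp Require Import all_classical all_reals all_analysis.
From mathcomp Require Import complex.
Set Implicit Arguments.
Unset Strict Implicit.
Unset Printing Implicit Defensive.
Import Order.TTheory GRing.Theory Num.Theory numFieldNormedType.Exports.
Local Open Scope classical_set_scope.
Local Open Scope complex_scope.
Local Open Scope ring_scope.

(* zeta^*({s}^n); the terms are nonnegative, so the sum is unordered and takes
   its value in the extended reals. [path leq 1 k] is 1 <= k_1 <= ... <= k_n. *)
Definition zeta_star (R : realType) (s n : nat) : \bar R :=
  \esum_(k in [set k : n.-tuple nat | path leq 1 k])
    ((\prod_(j <- k) j%:R : R) ^- s)%:E.

(* t / (e^t - 1) = \sum_n B_n t^n / n! for all real t near 0. The point t = 0 is
   excluded because t / (expR t - 1) is 0 there by the convention 0^-1 = 0. *)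
Definition is_bernoulli (R : realType) (B : nat -> R) : Prop :=
  \forall t \near (0 : R)^',
    pseries (fun n => B n / n`!%:R) t @ \oo --> t / (expR t - 1).

Definition cexp (R : realType) (z : R[i]) : R[i] :=
  let: x +i* y := z in (expR x)%:C * (cos y +i* sin y).

(* Main.v *)
(* With [z = exp(2 pi i / m)] and [m] odd, the product over [j < m] of
   [sin(pi z^j x) / (pi z^j x) = prod_k (1 - z^(2j) x^2 / k^2)] is
   [prod_k (1 - x^(2m) / k^(2m))], the inverse of the generating series of
   zeta^*({2m}^n) in [x^(2m)].  On the other hand, with [t_j = 2 pi i z^j x],
   [t_j / (exp t_j - 1) = exp(- t_j / 2) (pi z^j x / sin(pi z^j x))], and the
   exponentials multiply to 1 because the [z^j] sum to 0.  The formula compares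
   the coefficients of [x^(2mn)].

   Euler's product is only used through its finite analogue for [N = 2K + 1],
     [(1 + i t x)^N - (1 - i t x)^N =
      2 i N t x prod_(k <= K) (1 - t^2 cot^2(k pi / N) x^2)],
   at [t = pi / N].  The numbers [(pi / N)^2 cot^2(k pi / N)] are at most
   [1 / k^2] and tend to it, so the complete homogeneous sums of their [m]-th
   powers tend to zeta^*({2m}^n), while the coefficients of the left-hand side
   are explicit and converge. *)
Require Import Defs.
From HB Require Import structures.
From mathcomp Require Import all_boot all_order all_algebra.
From mathcomp Require Import all_classical all_reals all_analysis.
From mathcomp Require Import complex.
From mathcomp Require Import ring lra zify.
Import Order.TTheory GRing.Theory Num.Theory numFieldNormedType.Exports.
Local Open Scope classical_set_scope.
Local Open Scope complex_scope.
Local Open Scope ring_scope.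
Set Implicit Arguments.
Unset Strict Implicit.
Unset Printing Implicit Defensive.
Local Notation Re := complex.Re.
Local Notation Im := complex.Im.

(** * Truncated power series and complete homogeneous sums *)

(** Congruence modulo X^(T+1), degree T included: truncated polynomials stand for formal power
    series. *)
Definition congX (A : comNzRingType) T (p q : {poly A}) :=
  forall i, (i <= T)%N -> p`_i = q`_i.

Section CongX.
Variables (A : comNzRingType) (T : nat).
Implicit Types p q r : {poly A}.

Lemma congX_trans p q r : congX T p q -> congX T q r -> congX T p r.
Proof. by move=> pq qr i iT; rewrite pq ?qr. Qed.

Lemma congX_sym p q : congX T p q -> congX T q p.
Proof. by move=> pq i iT; rewrite pq. Qed.

Lemma congXM p p' q q' :
  congX T p p' -> congX T q q' -> congX T (p * q) (p' * q').
Proof.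
move=> pp' qq' i iT; rewrite !coefM; apply: eq_bigr => j _.
by rewrite pp' ?qq'// ?(leq_trans _ iT)// ?leq_subr// -ltnS ltn_ord.
Qed.

Lemma congX_prod I (s : seq I) (F G : I -> {poly A}) :
  (forall i, congX T (F i) (G i)) ->
  congX T (\prod_(i <- s) F i) (\prod_(i <- s) G i).
Proof.
move=> FG; apply: (big_ind2 (fun p q => congX T p q)) => //.
by move=> p p' q q'; exact: congXM.
Qed.

Lemma congX_addXM p q n : (T < n)%N -> congX T (p + 'X^n * q) p.
Proof.
move=> Tn i iT; rewrite coefD coefXnM (leq_ltn_trans iT Tn).
by rewrite addr0.
Qed.

End CongX.

(* The sum of [a k_1 ... a k_n] over [l <= k_1 <= ... <= k_n < u]. *)
Fixpoint hsum (A : pzSemiRingType) (a : nat -> A) (u n l : nat) : A :=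
  if n is n'.+1 then \sum_(l <= k < u) a k * hsum a u n' k else 1.

Lemma hsum_recl (A : comNzRingType) (a : nat -> A) u n l : (l < u)%N ->
  hsum a u n.+1 l = a l * hsum a u n l + hsum a u n.+1 l.+1.
Proof. by move=> lu /=; rewrite big_ltn. Qed.

(** Multiplying the generating series by the factor of index l removes l from the allowed indices,
    by [hsum_recl]; hence the induction on u - l. *)
Lemma hsum_gen (A : comNzRingType) (a : nat -> A) s T u l :
  (0 < s)%N -> (l <= u)%N ->
  congX T ((\sum_(r < T.+1) hsum a u r l *: 'X^(s * r)) *
           \prod_(l <= k < u) (1 - a k *: 'X^s)) 1.
Proof.
move=> s0; move: {2}(u - l)%N (erefl (u - l)%N) => d.
elim: d l => [|d IHd] l dE lu.
  have -> : l = u by lia.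
  rewrite big_geq// mulr1 big_ord_recl/= muln0 scale1r big1 ?addr0// => i _.
  by rewrite /= /bump/= add1n/= big_geq// scale0r.
rewrite big_ltn ?mulrA; last by lia.
have ludt : (l < u)%N by lia.
apply: congX_trans (IHd l.+1 _ _); [|lia|lia].
apply: congXM => //.
(* Cutting the series at r = T leaves one uncancelled term, of degree s(T+1) > T. *)
have -> : (\sum_(r < T.+1) hsum a u r l *: 'X^(s * r)) * (1 - a l *: 'X^s) =
  \sum_(r < T.+1) hsum a u r l.+1 *: 'X^(s * r) +
  'X^(s * T.+1) * (- (a l * hsum a u T l))%:P.
  elim: T {IHd} => [|T IHT].
    rewrite !big_ord_recl !big_ord0 !addr0 /= muln0 muln1 expr0 mulr1.
    by rewrite !scale1r mul1r mulrC mul_polyC scaleNr.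
  rewrite big_ord_recr/= mulrDl IHT [in RHS]big_ord_recr/= -!addrA; congr (_ + _).
  rewrite -!/(hsum a u _.+1 _) hsum_recl// [(s * T.+2)%N]mulnS addnC exprD.
  set y := 'X^(s * T.+1); rewrite -!mul_polyC !polyCN !polyCD !polyCM; ring.
by apply: congX_addXM; nia.
Qed.

(** * Factorizations over roots of unity *)

Section RootsOfUnity.
Variable F : numFieldType.

(** A nonzero p - q would have size(p - q) distinct integer roots, more than its degree. This lifts
    to polynomials a scalar identity proved by division. *)
Lemma poly_eq_nat (p q : {poly F}) :
  (forall k : nat, p.[k%:R] = q.[k%:R]) -> p = q.
Proof.
move=> pq; apply/eqP; rewrite -subr_eq0; apply/negPn/negP => d0.
pose s := [seq k%:R : F | k <- iota 0 (size (p - q))].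
have : (size s < size (p - q)%R)%N.
  apply: max_poly_roots => //.
    by apply/allP => x /mapP[k _ ->]; rewrite rootE !hornerE pq subrr.
  rewrite map_inj_uniq ?iota_uniq// => i j /eqP.
  by rewrite eqr_nat => /eqP.
by rewrite size_map size_iota ltnn.
Qed.

(** Homogenized form of X^n - 1 = prod_j (X - z^j), taken at x / y; the case y = 0 is set apart for
    the division. *)
Lemma prod_sub_prim_root (z : F) n (x y : F) : n.-primitive_root z ->
  \prod_(j < n) (x - z ^+ j * y) = x ^+ n - y ^+ n.
Proof.
move=> pz; have n0 := prim_order_gt0 pz.
have [->|y0] := eqVneq y 0.
  rewrite expr0n gtn_eqF// subr0; under eq_bigr do rewrite mulr0 subr0.
  by rewrite prodr_const card_ord.
have := congr1 (fun p => p.[x / y] * y ^+ n) (factor_Xn_sub_1 pz).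
rewrite horner_prod big_mkord.
rewrite -[X in _ * y ^+ X = _]card_ord -prodr_const -big_split/=.
rewrite !hornerE mulrBl mul1r expr_div_n mulfVK ?expf_neq0// => <-.
by apply: eq_bigr => i _; rewrite !hornerE mulrBl mulfVK.
Qed.

Lemma prod_sub_prim_rootP (z : F) n (x y : {poly F}) : n.-primitive_root z ->
  \prod_(j < n) (x - z ^+ j *: y) = x ^+ n - y ^+ n.
Proof.
move=> pz; apply: poly_eq_nat => k.
rewrite horner_prod !hornerE -(prod_sub_prim_root _ _ pz).
by apply: eq_bigr => j _; rewrite !hornerE.
Qed.

(* Since [m] is odd, the squares of the [m]-th roots of unity are again all
   the [m]-th roots of unity. *)
Lemma prod_comp_prim_root (w : F) m (a : nat -> F) (s : seq nat) :
  odd m -> m.-primitive_root w ->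
  \prod_(j < m) ((\prod_(k <- s) (1 - a k *: 'X^2)) \Po (w ^+ j *: 'X)) =
  \prod_(k <- s) (1 - a k ^+ m *: 'X^(2 * m)).
Proof.
move=> om pw; have pw2 : m.-primitive_root (w ^+ 2).
  by rewrite prim_root_exp_coprime ?coprime2n.
transitivity (\prod_(j < m) \prod_(k <- s) ((1 - a k *: 'X^2) \Po (w ^+ j *: 'X))).
  by apply: eq_bigr => j _; exact: rmorph_prod.
rewrite exchange_big/=; apply: eq_bigr => k _.
rewrite exprM -exprZn -[1 in RHS](expr1n _ m) -(prod_sub_prim_rootP _ _ pw2).
apply: eq_bigr => j _; rewrite comp_polyB comp_polyC comp_polyZ comp_Xn_poly.
by rewrite exprZn !scalerA mulrC -!exprM mulnC.
Qed.

End RootsOfUnity.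

(** * Complex numbers of modulus one *)

Section Cis.
Variable R : realType.
Implicit Types x y : R.

Definition cis x : R[i] := cos x +i* sin x.

Lemma cisD x y : cis (x + y) = cis x * cis y.
Proof.
by rewrite /cis cosD sinD; apply/eqP; rewrite eq_complex/= eqxx addrC eqxx.
Qed.

Lemma cis0 : cis 0 = 1.
Proof. by rewrite /cis cos0 sin0. Qed.

Lemma cisX x n : cis x ^+ n = cis (x * n%:R).
Proof.
elim: n => [|n IHn]; first by rewrite mulr0 cis0.
by rewrite exprS IHn -cisD mulrSr mulrDr mulr1 addrC.
Qed.

Lemma cos_lt1 x : 0 < x < pi *+ 2 -> cos x < 1.
Proof.
move=> x02; have : 0 < sin (x / 2) by apply: sin_gt0_pi; lra.
have -> : cos x = cos ((x / 2) *+ 2) by rewrite -mulr_natr divfK.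
rewrite cos_mulr2n; have := cos2Dsin2 (x / 2); nra.
Qed.

(** The order d of this root of unity divides n, and d < n would give cos(2 pi d / n) = 1 for an
    angle strictly between 0 and 2 pi. *)
Lemma cis_prim_root n : (0 < n)%N -> n.-primitive_root (cis (2 * pi / n%:R)).
Proof.
move=> n0; have n0R : (0 : R) < n%:R by rewrite ltr0n.
have pi0 := @pi_gt0 R.
have h : cis (2 * pi / n%:R) ^+ n = 1.
  by rewrite cisX divfK ?gt_eqF// mulr_natl /cis cos2pi sin2pi.
have [d pd dn] := prim_order_exists n0 h.
have [dE|dneq] := eqVneq d n; first by rewrite -{1}dE.
have d0 := prim_order_gt0 pd.
have dltn : (d < n)%N by rewrite ltn_neqAle dneq dvdn_leq.
have := prim_expr_order pd; rewrite cisX => -[c1 _].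
have : cos (2 * pi / n%:R * d%:R : R) < 1.
  have : 0 < (d%:R / n%:R : R) < 1.
    by rewrite divr_gt0 ?ltr0n//= ltr_pdivrMr// mul1r ltr_nat.
  rewrite mulrAC -mulrA; set q := d%:R / n%:R => /andP[q0 q1].
  by apply: cos_lt1; rewrite -mulr_natl; nra.
by rewrite c1 ltxx.
Qed.

End Cis.

(** * The finite sine product *)

Lemma coef_1DZX_exp (F : comNzRingType) (a : F) N k :
  ((1 + a *: 'X) ^+ N)`_k = a ^+ k *+ 'C(N, k).
Proof.
rewrite exprDn coef_sum.
under eq_bigr do rewrite expr1n mul1r exprZn coefMn coefZ coefXn.
have [kN|Nk] := leqP k N.
  rewrite (bigD1 (Ordinal (kN : k < N.+1)%N))//= eqxx mulr1 big1 ?addr0// => i.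
  by rewrite -val_eqE/= eq_sym => /negPf->; rewrite mulr0 mul0rn.
rewrite bin_small// mulr0n big1// => i _.
by rewrite [k == i]gtn_eqF ?mulr0 ?mul0rn// (leq_trans (ltn_ord i)).
Qed.

Lemma coef_comp_ZX (F : comNzRingType) (p : {poly F}) c i :
  (p \Po (c *: 'X))`_i = p`_i * c ^+ i.
Proof.
rewrite comp_polyE coef_sum.
under eq_bigr do rewrite exprZn scalerA coefZ coefXn.
have [ip|pi] := ltnP i (size p).
  rewrite (bigD1 (Ordinal ip))//= eqxx mulr1 big1 ?addr0// => j.
  by rewrite -val_eqE/= eq_sym => /negPf->; rewrite mulr0.
rewrite nth_default// mul0r big1// => j _.
by rewrite [i == j]gtn_eqF ?mulr0// (leq_trans (ltn_ord j)).
Qed.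

(** Pairs j with N - j for N = 2K + 1, two indices at which cot(j pi / N) takes opposite values. *)
Lemma big_odd_fold (M : comNzRingType) (f : nat -> M) K :
  \prod_(1 <= j < K.*2.+1) f j = \prod_(1 <= j < K.+1) (f j * f (K.*2.+1 - j)%N).
Proof.
rewrite (@big_cat_nat _ _ _ K.+1)//=; last by rewrite ltnS -addnn leq_addr.
rewrite big_split/=; congr (_ * _).
rewrite -{1}[K.+1]add1n big_addn -addnn -addSn addnK.
rewrite big_nat_rev/= add1n [LHS]big_nat [RHS]big_nat.
by apply: eq_bigr => j jK; congr (f _); lia.
Qed.

Section FiniteSine.
Variable R : realType.
Local Notation C := R[i].

Definition cotg (x : R) := cos x / sin x.

(** From 1 + e^(2ix) = 2 cos(x) e^(ix) and 1 - e^(2ix) = -2i sin(x) e^(ix) comes i (1 + e^(2ix)) = -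
    cot(x) (1 - e^(2ix)), which is [key]. *)
Lemma factor_cotg (x t : R) : sin x != 0 ->
  (1 + ('i%C * t%:C) *: 'X) - cis (x *+ 2) *: (1 - ('i%C * t%:C) *: 'X) =
  (1 - cis (x *+ 2)) *: (1 - (t * cotg x)%:C *: 'X) :> {poly C}.
Proof.
move=> sx0; have cE : cos x = cotg x * sin x by rewrite /cotg divfK.
have := cos2Dsin2 x; set q := cotg x in cE *; move=> cs1.
have key : 'i%C * t%:C * (1 + cis (x *+ 2)) =
    - ((1 - cis (x *+ 2)) * (t * q)%:C) :> C.
  rewrite mulr2n cisD /cis cE; apply/eqP; rewrite eq_complex/=; apply/andP.
  rewrite cE in cs1.
  have e1 : 1 - (q * sin x * (q * sin x) - sin x * sin x) = 2 * sin x ^+ 2.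
    by rewrite -[X in X - _]cs1; ring.
  have e2 : 1 + (q * sin x * (q * sin x) - sin x * sin x) =
      2 * (q * sin x) ^+ 2 by rewrite -[X in X + _]cs1; ring.
  by split; apply/eqP; rewrite e1 e2; ring.
move: (cis _) ((t * q)%:C) key => z tq key.
rewrite [LHS](_ : _ = (1 - z)%:P + ('i%C * t%:C * (1 + z))%:P * 'X).
  by rewrite key -!mul_polyC !(polyCM, polyCN, polyCD); ring.
by rewrite -!mul_polyC !(polyCM, polyCN, polyCD); ring.
Qed.

(** With A = 1 + itX and B = 1 - itX, A^N - B^N is the product of the A - z^k B over the N-th roots
    of unity. The factor k = 0 is 2itX, [factor_cotg] rewrites the others, and pairing k with N - k
    leaves squares. *)
Lemma finite_sine_prod K (t : R) :
  (1 + ('i%C * t%:C) *: 'X) ^+ K.*2.+1 - (1 - ('i%C * t%:C) *: 'X) ^+ K.*2.+1 =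
  (2 * 'i%C * (K.*2.+1%:R * t)%:C) *: ('X * \prod_(1 <= k < K.+1)
    (1 - ((t * cotg (pi / K.*2.+1%:R * k%:R)) ^+ 2)%:C *: 'X^2)) :> {poly C}.
Proof.
set N := K.*2.+1; have N0 : (0 : R) < N%:R by rewrite ltr0n.
have pi0 := @pi_gt0 R.
pose z : C := cis (2 * pi / N%:R).
have pz : N.-primitive_root z by exact: cis_prim_root.
pose th k : R := pi / N%:R * k%:R.
have thE k : z ^+ k = cis (th k *+ 2).
  by rewrite /z cisX -mulr_natl; congr cis; rewrite /th; ring.
have sth k : (0 < k < N)%N -> sin (th k) != 0.
  case/andP=> k0 kN; rewrite gt_eqF// sin_gt0_pi// /th mulrAC -mulrA.
  have : 0 < (k%:R / N%:R : R) < 1.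
    by rewrite divr_gt0 ?ltr0n//= ltr_pdivrMr// mul1r ltr_nat.
  by set q := _ / _ => /andP[q0 q1]; nra.
pose g k : {poly C} := 1 - (t * cotg (th k))%:C *: 'X.
have gfold : \prod_(1 <= k < N) g k =
    \prod_(1 <= k < K.+1) (1 - ((t * cotg (th k)) ^+ 2)%:C *: 'X^2).
  rewrite big_odd_fold big_nat [RHS]big_nat; apply: eq_bigr => k /andP[k1 kK].
  have -> : g (K.*2.+1 - k)%N = 1 + (t * cotg (th k))%:C *: 'X.
    have thN : th (K.*2.+1 - k)%N = - th k + pi.
      rewrite /th natrB; last by rewrite ltnW// -addnn; lia.
      by rewrite -/N mulrBr divfK ?gt_eqF// addrC.
    rewrite /g thN /cotg sinDpi cosDpi sinN cosN opprK mulNr mulrN.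
    by rewrite rmorphN/= scaleNr opprK.
  rewrite /g -!mul_polyC !(rmorphM, rmorphXn)/=; ring.
pose ka : C := \prod_(1 <= k < N) (1 - z ^+ k).
have fact : (1 + ('i%C * t%:C) *: 'X) ^+ N - (1 - ('i%C * t%:C) *: 'X) ^+ N =
    ((2 * 'i%C * t%:C * ka) *: 'X) * \prod_(1 <= k < N) g k.
  rewrite -(prod_sub_prim_rootP _ _ pz).
  rewrite -(big_mkord xpredT (fun j => 1 + ('i%C * t%:C) *: 'X -
    z ^+ j *: (1 - ('i%C * t%:C) *: 'X))) big_ltn// expr0 scale1r.
  rewrite [X in _ * X](_ : _ = ka *: \prod_(1 <= k < N) g k).
    rewrite -!mul_polyC !polyCM; ring.
  rewrite /ka -[RHS]mul_polyC (big_morph _ (@polyCM _) (polyC1 _)) -big_split/=.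
  rewrite big_nat [RHS]big_nat.
  by apply: eq_bigr => k kN; rewrite thE factor_cotg ?sth// mul_polyC.
(* Both sides vanish at t = 0. Otherwise the constant [ka] is found by comparing the coefficients of
   X, 2itN on the left and 2it [ka] on the right. *)
case: (eqVneq t 0) => [->|t0].
  by rewrite !mulr0 !scale0r addr0 subr0 subrr.
have i0 : 'i%C != 0 :> C by rewrite eq_complex/= oner_eq0 andbF.
have tC0 : t%:C != 0 :> C by rewrite fmorph_eq0.
have kaE : ka = N%:R.
  have := congr1 (fun p : {poly C} => p`_1) fact.
  rewrite -scaleNr coefB !coef_1DZX_exp bin1 expr1.
  rewrite -scalerAl coefZ coefXM/= -horner_coef0 horner_prod big1 => [|k _].
    rewrite mulr1 mulNrn opprK -mulr_natr.
    rewrite (_ : _ + _ = 2 * 'i%C * t%:C * N%:R); last by ring.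
    by move/mulfI => ->//; rewrite !mulf_neq0// pnatr_eq0.
  by rewrite /g !hornerE ?mulr0 ?subr0.
rewrite fact gfold kaE -scalerAl; congr (_ *: _).
by rewrite rmorphM/= rmorph_nat -!mulrA [_ * N%:R]mulrC.
Qed.

End FiniteSine.

(** * Limits *)

Section CotangentBounds.
Variable R : realType.
Implicit Types x : R.

(** The function sin y - y cos y vanishes at 0 and has derivative y sin y, nonnegative on
    [0, pi]. *)
Lemma xcos_le_sin x : 0 <= x <= pi -> x * cos x <= sin x.
Proof.
case/andP=> x0 xpi; rewrite -subr_ge0.
pose f := fun y : R => sin y - y * cos y.
have df (y : R) : is_derive y 1 f (y * sin y).
  apply: is_derive_eq; rewrite /GRing.scale/=; ring.
have -> : 0 = f 0 by rewrite /f sin0 mul0r subrr.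
apply: (@ger0_derive1_ndecr _ f 0 pi) => //.
- by move=> y /[!in_itv]/= /andP[y0 ypi]; rewrite derive1E derive_val
    mulr_ge0 ?sin_ge0_pi ?ltW// (ltW y0) ltW.
- by apply: derivable_within_continuous => y _; exact: ex_derive.
Qed.

Lemma mul_cotg_le1 x : 0 < x < pi -> x * cotg x <= 1.
Proof.
move=> /andP[x0 xpi]; rewrite mulrA ler_pdivrMr ?sin_gt0_pi ?x0// mul1r.
by rewrite xcos_le_sin// !ltW.
Qed.

Lemma cotg_ge0 x : 0 < x <= pi / 2 -> 0 <= cotg x.
Proof.
have pi0 := @pi_gt0 R; move=> /andP[x0 xpi]; rewrite divr_ge0//.
  by apply: cos_ge0_pihalf; rewrite xpi andbT; lra.
by apply: sin_ge0_pi; lra.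
Qed.

(** Caratheodory's form of the derivative gives sin u = u g(u) with g continuous at 0 and g(0) = 1,
    so that u cot u = cos u / g(u). *)
Lemma cvg_mul_cotg (u : R^nat) : (forall k, u k != 0) ->
  u @ \oo --> 0 -> u k * cotg (u k) @[k --> \oo] --> (1 : R).
Proof.
move=> u0 cu.
have [g [gE cg g0]] :=
  (is_derive1_caratheodory _ _ _).1 (is_derive_sin (0 : R)).
rewrite cos0 in g0.
(* This also holds where g(u k) = 0, both sides being 0 by the convention 0^-1 = 0. *)
have -> : (fun k => u k * cotg (u k)) = (fun k => cos (u k) / g (u k)).
  apply/funext => k; have := gE (u k); rewrite sin0 !subr0 /cotg => ->.
  by rewrite invfM mulrCA [u k * _]mulrCA divff ?mulr1.
rewrite -[X in _ --> X]divr1 -{1}(@cos0 R) -g0.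
apply: cvgM.
  by apply: continuous_cvg => //; exact: continuous_cos.
apply: cvgV; first by rewrite g0 oner_eq0.
exact: continuous_cvg.
Qed.

End CotangentBounds.

Section BinomialLimit.
Variable R : realType.

Lemma cvg_invn : (n%:R^-1 : R) @[n --> \oo] --> 0.
Proof.
apply/gtr0_cvgV0; last exact: cvgr_idn.
by near=> n; rewrite ltr0n; near: n; exact: nbhs_infty_gt.
Unshelve. all: by end_near. Qed.

Lemma cvg_odd : K.*2.+1 @[K --> \oo] --> \oo.
Proof.
apply/cvgnyPge => A; near=> K.
have AK : (A <= K)%N by near: K; exact: nbhs_infty_ge.
lia.
Unshelve. all: by end_near. Qed.

(** Passing from s to s + 1 multiplies the quotient by (1 - s/n) / (s + 1). *)
Lemma cvg_bin_expn s :
  ('C(n, s)%:R / n%:R ^+ s : R) @[n --> \oo] --> (s`!%:R^-1 : R).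
Proof.
elim: s => [|s IHs].
  under eq_fun do rewrite bin0 expr0 divr1.
  by rewrite fact0 invr1; exact: cvg_cst.
have h : ('C(n, s)%:R / n%:R ^+ s * ((1 - s%:R * n%:R^-1) / s.+1%:R) : R)
   @[n --> \oo] --> (s`!%:R^-1 * ((1 - s%:R * 0) / s.+1%:R) : R).
  apply: cvgM => //; apply: cvgM; last exact: cvg_cst.
  apply: cvgB; first exact: cvg_cst.
  by apply: cvgM; [exact: cvg_cst|exact: cvg_invn].
rewrite factS natrM invfM.
rewrite mulr0 subr0 div1r mulrC in h.
apply: cvg_trans h; apply: near_eq_cvg; near=> n.
have n0 : (s < n)%N by near: n; exact: nbhs_infty_gt.
have nR : (n%:R : R) != 0 by rewrite pnatr_eq0; lia.
have sR : (s.+1%:R : R) != 0 by rewrite pnatr_eq0.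
have := mul_bin_left n s => /(congr1 (fun k => k%:R : R)).
rewrite !natrM natrB ?(ltnW n0)// => e.
have -> : 'C(n, s.+1)%:R = (n%:R - s%:R) * 'C(n, s)%:R / s.+1%:R :> R.
  by rewrite -e mulrAC divff ?mul1r.
rewrite exprSr; field.
by rewrite nR expf_neq0 ?nR// nat1r sR.
Unshelve. all: by end_near. Qed.

End BinomialLimit.

(** * Coefficientwise limits of complex polynomials *)

Section ComplexLimit.
Variable R : realType.
Local Notation C := R[i].

(** Taking the two parts separately reduces everything to real limits, and shows at once that a
    limit of real numbers is real. *)
Definition ccvg (u : nat -> C) (l : C) :=
  (Re (u k) @[k --> \oo] --> Re l) /\ (Im (u k) @[k --> \oo] --> Im l).

Lemma ccvg_cst c : ccvg (fun=> c) c.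
Proof. by split; exact: cvg_cst. Qed.

Lemma Re_add (x y : C) : Re (x + y) = Re x + Re y.
Proof. by case: x; case: y. Qed.

Lemma Im_add (x y : C) : Im (x + y) = Im x + Im y.
Proof. by case: x; case: y. Qed.

Lemma Re_mul (x y : C) : Re (x * y) = Re x * Re y - Im x * Im y.
Proof. by case: x; case: y. Qed.

Lemma Im_mul (x y : C) : Im (x * y) = Re x * Im y + Im x * Re y.
Proof. by case: x; case: y. Qed.

Lemma ccvgD u v l l' : ccvg u l -> ccvg v l' ->
  ccvg (fun k => u k + v k) (l + l').
Proof.
move=> [ru iu] [rv iv]; split.
  by under eq_fun do rewrite Re_add; rewrite Re_add; exact: cvgD.
by under eq_fun do rewrite Im_add; rewrite Im_add; exact: cvgD.
Qed.

Lemma ccvgM u v l l' : ccvg u l -> ccvg v l' ->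
  ccvg (fun k => u k * v k) (l * l').
Proof.
move=> [ru iu] [rv iv]; split.
  under eq_fun do rewrite Re_mul; rewrite Re_mul.
  by apply: cvgB; exact: cvgM.
under eq_fun do rewrite Im_mul; rewrite Im_mul.
by apply: cvgD; exact: cvgM.
Qed.

Lemma ccvgB u v l l' : ccvg u l -> ccvg v l' ->
  ccvg (fun k => u k - v k) (l - l').
Proof.
move=> cu cv; rewrite -mulN1r (_ : (fun k => _) = (fun k => u k + -1 * v k)).
  by apply: ccvgD => //; apply: ccvgM => //; exact: ccvg_cst.
by apply/funext => k; rewrite mulN1r.
Qed.

Lemma ccvg_sum (I : Type) (s : seq I) (u : I -> nat -> C) (l : I -> C) :
  (forall i, ccvg (u i) (l i)) ->
  ccvg (fun k => \sum_(i <- s) u i k) (\sum_(i <- s) l i).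
Proof.
move=> cu; elim: s => [|i s IHs].
  under eq_fun do rewrite big_nil; rewrite big_nil; exact: ccvg_cst.
under eq_fun do rewrite big_cons; rewrite big_cons; exact: ccvgD.
Qed.

Lemma ccvg_real (u : R^nat) (l : R) : u @ \oo --> l -> ccvg (fun k => (u k)%:C) l%:C.
Proof. by move=> cu; split => //; exact: cvg_cst. Qed.

Lemma ccvg_coef_prod (I : Type) (s : seq I) (p : I -> nat -> {poly C})
    (q : I -> {poly C}) T :
  (forall i j, (j <= T)%N -> ccvg (fun k => (p i k)`_j) (q i)`_j) ->
  forall j, (j <= T)%N ->
    ccvg (fun k => (\prod_(i <- s) p i k)`_j) (\prod_(i <- s) q i)`_j.
Proof.
move=> pq; elim: s => [|i s IHs] j jT.
  under eq_fun do rewrite big_nil; rewrite big_nil; exact: ccvg_cst.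
under eq_fun do rewrite big_cons coefM; rewrite big_cons coefM.
apply: (@ccvg_sum _ _ (fun (a : 'I_j.+1) k => (p i k)`_a *
   (\prod_(i <- s) p i k)`_(j - a)) (fun a : 'I_j.+1 => (q i)`_a *
   (\prod_(i <- s) q i)`_(j - a))) => a.
by apply: ccvgM; [apply: pq|apply: IHs]; have := ltn_ord a; lia.
Qed.

(** The coefficients of an inverse satisfy G_j = [j = 0] - sum_(i < j) G_i D_(j-i), so their
    convergence follows by strong induction from that of the D_j. *)
Lemma ccvg_coef_inv (G D : nat -> {poly C}) (G0 D0 : {poly C}) T :
  (forall k, (D k)`_0 = 1) -> D0`_0 = 1 ->
  (forall k, congX T (G k * D k) 1) -> congX T (G0 * D0) 1 ->
  (forall j, (j <= T)%N -> ccvg (fun k => (D k)`_j) D0`_j) ->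
  forall j, (j <= T)%N -> ccvg (fun k => (G k)`_j) G0`_j.
Proof.
move=> Dk1 D01 GD GD0 cD j; elim/ltn_ind: j => j IHj jT.
have inv_rec (G1 D1 : {poly C}) : D1`_0 = 1 -> congX T (G1 * D1) 1 ->
    G1`_j = (j == 0%N)%:R - \sum_(i < j) G1`_i * D1`_(j - i).
  move=> D11 /(_ _ jT); rewrite coefM big_ord_recr/= subnn D11 mulr1 coef1.
  by move<-; rewrite [X in _ = X - _]addrC addrK.
rewrite (inv_rec _ _ D01 GD0).
under eq_fun do rewrite (inv_rec _ _ (Dk1 _) (GD _)).
apply: ccvgB; first exact: ccvg_cst.
apply: (@ccvg_sum _ _ (fun (i : 'I_j) k => (G k)`_i * (D k)`_(j - i))
  (fun i : 'I_j => G0`_i * D0`_(j - i))) => i.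
by apply: ccvgM; [apply: IHj|apply: cD]; have := ltn_ord i; lia.
Qed.

End ComplexLimit.

(** * Monotonicity and limits of complete homogeneous sums *)

Section HsumOrder.
Variable R : realType.
Implicit Types a b : nat -> R.

Lemma hsum_ge0 a u n l : (forall k, 0 <= a k) -> 0 <= hsum a u n l.
Proof.
move=> a0; elim: n l => [|n IHn] l //=.
by apply: sumr_ge0 => k _; rewrite mulr_ge0.
Qed.

Lemma hsum_le a b u n l : (forall k, 0 <= a k) ->
  (forall k, (l <= k < u)%N -> a k <= b k) -> hsum a u n l <= hsum b u n l.
Proof.
move=> a0; elim: n l => [|n IHn] l ab //=.
rewrite big_nat [leRHS]big_nat; apply: ler_sum => k lku.
rewrite ler_pM ?hsum_ge0 ?ab//; apply: IHn => j /andP[kj ju].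
by apply: ab; rewrite ju andbT (leq_trans _ kj)//; case/andP: lku.
Qed.

Lemma hsum_homo a u v n l : (forall k, 0 <= a k) -> (u <= v)%N ->
  hsum a u n l <= hsum a v n l.
Proof.
move=> a0 uv; elim: n l => [|n IHn] l //=.
have [ul|lu] := leqP u l.
  by rewrite big_geq// sumr_ge0// => k _; rewrite mulr_ge0 ?hsum_ge0.
rewrite [leRHS](@big_cat_nat _ _ _ u)//= ?(ltnW lu)// -[leLHS]addr0 lerD//.
  by apply: ler_sum => k _; rewrite ler_wpM2l.
by rewrite sumr_ge0// => k _; rewrite mulr_ge0 ?hsum_ge0.
Qed.

Lemma cvg_sum_seq (I : eqType) (s : seq I) (f : I -> R^nat) (l : I -> R) :
  (forall i, i \in s -> f i @ \oo --> l i) ->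
  \sum_(i <- s) f i n @[n --> \oo] --> \sum_(i <- s) l i.
Proof.
elim: s => [|i s IHs] fl.
  by under eq_fun do rewrite big_nil; rewrite big_nil; exact: cvg_cst.
under eq_fun do rewrite big_cons; rewrite big_cons.
apply: cvgD; first by apply: fl; rewrite mem_head.
by apply: IHs => j js; apply: fl; rewrite in_cons js orbT.
Qed.

Lemma cvg_hsum (a : nat -> nat -> R) b u n l :
  (forall k, (l <= k)%N -> a K k @[K --> \oo] --> b k) ->
  hsum (a K) u n l @[K --> \oo] --> hsum b u n l.
Proof.
elim: n l => [|n IHn] l ab /=; first exact: cvg_cst.
apply: cvg_sum_seq => k; rewrite mem_index_iota => /andP[lk _].
apply: cvgM; first exact: ab.
by apply: IHn => j kj; apply: ab; exact: leq_trans kj.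
Qed.

End HsumOrder.

(** * Complete homogeneous sums and unordered sums *)

Section NondecreasingTuples.

(** The finite index set of [hsum] as a list without repetition of actual tuples, to be compared
    with the finite subsets that define [\esum]. *)
Fixpoint ndtuples (u n l : nat) : seq (n.-tuple nat) :=
  if n is n'.+1 return seq (n.-tuple nat) then
    [seq cons_tuple k t | k <- index_iota l u, t <- ndtuples u n' k]
  else [:: [tuple]].

Lemma mem_ndtuples u n l (t : n.-tuple nat) :
  (t \in ndtuples u n l) = path leq l t && all (ltn^~ u) t.
Proof.
elim: n l t => [|n IHn] l t /=; first by rewrite [t]tuple0 mem_head.
apply/allpairsPdep/idP => [[k [s [+ + ->]]]|].
  by rewrite mem_index_iota IHn /= => /andP[-> ->] /andP[-> ->].
case/tupleP: t => k s /= /andP[/andP[lk ks] /andP[ku su]].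
by exists k, s; rewrite mem_index_iota lk ku IHn ks su.
Qed.

Lemma uniq_ndtuples u n l : uniq (ndtuples u n l).
Proof.
elim: n l => [|n IHn] l //=.
apply: allpairs_uniq_dep => [|k _|]; [exact: iota_uniq|exact: IHn|].
move=> [k s] [k' s'] _ _ /(congr1 val)/= [<-] /val_inj ss'.
by rewrite ss'.
Qed.

Lemma sum_ndtuples (A : pzSemiRingType) (a : nat -> A) u n l :
  \sum_(t <- ndtuples u n l) \prod_(j <- t) a j = hsum a u n l.
Proof.
elim: n l => [|n IHn] l /=; first by rewrite big_seq1 big_nil.
rewrite big_allpairs_dep/=; apply: eq_bigr => k _.
by rewrite -IHn mulr_sumr; apply: eq_bigr => t _; rewrite big_cons.
Qed.

Variables (R : realType) (a : nat -> R).
Hypothesis a0 : forall k, 0 <= a k.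
Local Notation zsum n l := (\esum_(k in [set k : n.-tuple nat | path leq l k])
  (\prod_(j <- k) a j)%:E).

Lemma hsum_le_esum u n l : ((hsum a u n l)%:E <= zsum n l)%E.
Proof.
apply: esum_ge; exists [set` ndtuples u n l].
  split; first exact: finite_seq.
  by move=> t /=; rewrite mem_ndtuples => /andP[].
by rewrite -fsbig_seq ?uniq_ndtuples// sumEFin sum_ndtuples.
Qed.

Lemma esum_le_hsum L n l : (forall u, hsum a u n l <= L) ->
  (zsum n l <= L%:E)%E.
Proof.
move=> hL; apply: ge_ereal_sup => _ [X [finX XI] <-].
(* One more than the largest entry in X, so that all tuples of X are among [ndtuples u n l]. *)
pose u := (\max_(t <- finmap.enum_fset (fset_set X)) \max_(j <- t) j).+1.
apply: (@le_trans _ _ (hsum a u n l)%:E); last by rewrite lee_fin.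
rewrite -sum_ndtuples -sumEFin [leRHS]fsbig_seq ?uniq_ndtuples//.
apply: lee_fsum_nneg_subset => //.
  move=> t; rewrite !inE/= => tX; rewrite mem_ndtuples (XI _ tX)/=.
  apply/allP => j jt; rewrite /u ltnS.
  apply: (@leq_trans (\max_(j <- t) j)).
    exact: (@leq_bigmax_seq _ _ xpredT id).
  apply: (@leq_bigmax_seq _ _ xpredT
    (fun t : n.-tuple nat => \max_(j <- t) j)) => //.
  by rewrite in_fset_set// inE.
by move=> t _; rewrite lee_fin prodr_ge0.
Qed.

End NondecreasingTuples.

(** * Bernoulli numbers *)

Section PowerSeriesInverse.
Variable R : realType.
Implicit Types (b c : nat -> R) (f g : R -> R).

Lemma geometric_sum_le2 (q : R) d : 0 <= q <= 1 / 2 ->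
  \sum_(i < d) q ^+ i <= 2.
Proof.
case/andP=> q0 q1; have := subrX1 q d; set s := \sum_(i < d) _ => e.
have qd : 0 <= q ^+ d by rewrite exprn_ge0.
have s0 : 0 <= s by apply: sumr_ge0 => i _; rewrite exprn_ge0.
nra.
Qed.

(** Convergence at one point r > 0 bounds all |b_i r^i| by some K. For |t| < r/2 the tail from T on
    is at most K (|t|/r)^T times a geometric sum of ratio at most 1/2, whence the 2 in [M]. *)
Lemma pseries_remainder b f T :
  (\forall t \near 0^', pseries b t @ \oo --> f t) ->
  exists M, \forall t \near 0^',
    `|f t - \sum_(i < T) b i * t ^+ i| <= M * `|t| ^+ T.
Proof.
move=> bf; have [/= e e0 he] := bf.
have [r r0 re] : exists2 r, 0 < r & r < e by exists (e / 2); lra.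
have br : pseries b r @ \oo --> f r.
  apply: he => /=; last by rewrite gt_eqF.
  by rewrite sub0r normrN gtr0_norm.
have /cvg_series_bounded : cvgn (pseries b r) by apply/cvg_ex; exists (f r).
move=> [K0 [_ hK0]]; pose K : R := `|K0| + 1.
have hK i : `|b i * r ^+ i| <= K.
  by apply: (hK0 K _ i I); rewrite ltr_pwDr ?ltr01 ?ler_norm.
pose M : R := 2 * K / r ^+ T; exists M.
exists (r / 2) => /=; first by rewrite divr_gt0.
move=> t /=; rewrite sub0r normrN => tr t0.
have ct : pseries b t @ \oo --> f t.
  by apply: he => //=; rewrite sub0r normrN; lra.
have K_ge0 : 0 <= K by rewrite addr_ge0.
have bound n : (T <= n)%N ->
    `|pseries b t n - \sum_(i < T) b i * t ^+ i| <= M * `|t| ^+ T.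
  move=> Tn; rewrite /pseries /series/= (@big_cat_nat _ _ _ T)//=.
  rewrite big_mkord [X in _ <= X](_ : _ = K * (`|t| / r) ^+ T * 2); last first.
    by rewrite /M expr_div_n; ring.
  rewrite [X in X - _]addrC addrK -{1}[T]add0n big_addn big_mkord.
  apply: le_trans (ler_norm_sum _ _ _) _.
  have q0 : 0 <= `|t| / r <= 1 / 2.
    rewrite divr_ge0 ?(ltW r0)//= ler_pdivrMr//; lra.
  apply: le_trans (_ : K * (`|t| / r) ^+ T * \sum_(i < n - T) (`|t| / r) ^+ i <= _).
    rewrite mulr_sumr; apply: ler_sum => i _.
    rewrite -mulrA -exprD addnC normrM normrX expr_div_n.
    rewrite [in leRHS]mulrCA mulrC ler_wpM2l ?exprn_ge0// ler_pdivlMr ?exprn_gt0//.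
    apply: le_trans (hK (T + i)%N).
    by rewrite normrM normrX (gtr0_norm r0).
  rewrite ler_wpM2l ?geometric_sum_le2// mulr_ge0// exprn_ge0//.
  by case/andP: q0.
apply: (@ler_cvg_to _ \oo _ _ (fun n => `|pseries b t n - \sum_(i < T) b i * t ^+ i|)
   (fun=> M * `|t| ^+ T)).
- exact: (cvg_norm (cvgB ct (cvg_cst _))).
- exact: cvg_cst.
- by near=> n; apply: bound; near: n; exact: nbhs_infty_ge.
Unshelve. all: by end_near. Qed.

Lemma cvg_horner_dnbhs (p : {poly R}) : p.[t] @[t --> 0^'] --> p.[0].
Proof. by apply: cvg_within_filter; exact: continuous_horner. Qed.

(** If the coefficients below i vanish, then p = q X^i with |q(t)| <= M |t|^(T-i), which tends to 0;
    hence q(0), the coefficient of index i, is 0. *)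
Lemma coef_eq0_near (p : {poly R}) M T :
  (\forall t \near 0^', `|p.[t]| <= M * `|t| ^+ T) ->
  forall i, (i < T)%N -> p`_i = 0.
Proof.
move=> pM i; elim/ltn_ind: i => i IHi iT.
have pE := poly_take_drop i p.
have tp0 : take_poly i p = 0.
  apply/polyP => j; rewrite coef_take_poly coef0.
  by case: ifP => // ji; rewrite IHi// (ltn_trans ji).
rewrite tp0 add0r in pE; set q := drop_poly i p in pE.
have q0 : q.[0] = p`_i by rewrite horner_coef0 coef_drop_poly.
have cq := @cvg_horner_dnbhs q.
rewrite -q0; apply/eqP; rewrite -normr_le0.
apply: (@ler_cvg_to _ (0^') _ _ (fun t => `|q.[t]|) (fun t => M * `|t| ^+ (T - i))).
- exact: (cvg_norm cq).
- have : M * `|('X^(T - i)).[t]| @[t --> 0^'] --> M * `|('X^(T - i)).[0]|.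
    apply: cvgM; first exact: cvg_cst.
    exact: (cvg_norm (@cvg_horner_dnbhs 'X^(T - i))).
  rewrite hornerXn expr0n subn_eq0 leqNgt iT normr0 mulr0.
  by under eq_fun do rewrite hornerXn normrX.
- near=> t; have t0 : 0 < `|t|.
    by rewrite normr_gt0; near: t; exact: nbhs_dnbhs_neq.
  rewrite -(ler_pM2r (exprn_gt0 i t0)) -mulrA -exprD subnK ?(ltnW iT)//.
  rewrite -normrX -normrM -hornerXn -hornerM pE.
  by near: t.
Unshelve. all: by end_near. Qed.

(* No Cauchy product is needed: the remainders show that the product of the
   truncations is [1 + O(t^(T+1))] at 0. *)
Lemma pseries_inv b c f g T :
  (\forall t \near 0^', pseries b t @ \oo --> f t) ->
  (\forall t \near 0^', pseries c t @ \oo --> g t) ->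
  (\forall t \near 0^', f t * g t = 1) ->
  congX T ((\poly_(i < T.+1) b i) * (\poly_(i < T.+1) c i)) 1.
Proof.
move=> bf cg fg; set p := \poly_(i < _) b i; set q := \poly_(i < _) c i.
have [M1 hM1] := pseries_remainder T.+1 bf.
have [M2 hM2] := pseries_remainder T.+1 cg.
have bnd (r : {poly R}) : exists K, \forall t \near 0^', `|r.[t]| <= K.
  exists (`|r.[0]| + 1).
  have := @cvg_horner_dnbhs r.
  by move/cvgr_norm_le; apply; rewrite ltrDl.
have [K1 hK1] := bnd p; have [K2 hK2] := bnd q.
suff h : \forall t \near 0^', `|(1 - p * q).[t]| <=
    (`|M1| * K2 + `|M1| * `|M2| + K1 * `|M2|) * `|t| ^+ T.+1.
  move=> i iT; have := coef_eq0_near h iT.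
  by rewrite coefB => /eqP; rewrite subr_eq0 => /eqP.
near=> t.
have t1 : `|t| <= 1.
  near: t; exists 1 => //= s /=.
  by rewrite sub0r normrN => /ltW.
have e1 : `|f t - p.[t]| <= `|M1| * `|t| ^+ T.+1.
  apply: (@le_trans _ _ (M1 * `|t| ^+ T.+1)); last first.
    by rewrite ler_wpM2r ?exprn_ge0 ?ler_norm.
  by rewrite horner_poly; near: t.
have e2 : `|g t - q.[t]| <= `|M2| * `|t| ^+ T.+1.
  apply: (@le_trans _ _ (M2 * `|t| ^+ T.+1)); last first.
    by rewrite ler_wpM2r ?exprn_ge0 ?ler_norm.
  by rewrite horner_poly; near: t.
have k1 : `|p.[t]| <= K1 by near: t.
have k2 : `|q.[t]| <= K2 by near: t.
have -> : (1 - p * q).[t] = (f t - p.[t]) * q.[t] +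
    (f t - p.[t]) * (g t - q.[t]) + p.[t] * (g t - q.[t]).
  rewrite !hornerE -(_ : f t * g t = 1); first by ring.
  by near: t.
(* In the product of the two remainders, this bounds that of g by the constant |M2|. *)
have tT : `|t| ^+ T.+1 <= 1 by rewrite exprn_ile1.
have := normr_ge0 (f t - p.[t]); have := normr_ge0 (g t - q.[t]).
have := normr_ge0 p.[t]; have := normr_ge0 q.[t].
have T0 : 0 <= `|t| ^+ T.+1 by rewrite exprn_ge0.
have M10 := normr_ge0 M1; have M20 := normr_ge0 M2.
move=> q_ge0 p_ge0 g_ge0 f_ge0; rewrite [leRHS]mulrDl [X in _ <= X + _]mulrDl.
apply: le_trans (ler_normD _ _) _; rewrite lerD//.
  apply: le_trans (ler_normD _ _) _; rewrite lerD//.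
    by rewrite normrM mulrAC ler_pM.
  rewrite normrM mulrAC ler_pM//; apply: le_trans e2 _.
  by rewrite -[leRHS]mulr1 ler_wpM2l.
by rewrite normrM -mulrA ler_pM.
Unshelve. all: by end_near. Qed.

Lemma cvg_pseries_exp_tail (t : R) : t != 0 ->
  pseries (fun i => (i.+1`!%:R)^-1) t @ \oo --> (expR t - 1) / t.
Proof.
move=> t0.
have h : (series (exp_coeff t) n.+1 - 1) / t @[n --> \oo] --> (expR t - 1) / t.
  apply: cvgM; last exact: cvg_cst.
  apply: cvgB; last exact: cvg_cst.
  have := is_cvg_series_exp_coeff t; rewrite -(cvg_shiftS (series _)).
  exact.
apply: cvg_trans h; apply: near_eq_cvg; near=> n.
rewrite /pseries /series/= big_nat_recl//=.
have -> : exp_coeff t 0%N = 1 by rewrite /exp_coeff/= fact0 divr1.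
rewrite addrAC subrr add0r.
rewrite mulr_suml; apply: eq_bigr => i _.
by rewrite /exp_coeff/= exprS; field; rewrite t0 pnatr_eq0 -lt0n fact_gt0.
Unshelve. all: by end_near. Qed.

(** Turns the analytic definition of the Bernoulli numbers into a formal identity: t / (e^t - 1) and
    (e^t - 1) / t multiply to 1 away from 0. *)
Lemma bernoulli_poly_inv (B : nat -> R) T : is_bernoulli B ->
  congX T ((\poly_(i < T.+1) (B i / i`!%:R)) *
           (\poly_(i < T.+1) (i.+1`!%:R)^-1)) 1.
Proof.
move=> hB; apply: (@pseries_inv _ _ (fun t => t / (expR t - 1))
  (fun t => (expR t - 1) / t)) => //.
- by near=> t; apply: cvg_pseries_exp_tail; near: t; exact: nbhs_dnbhs_neq.
- near=> t; have t0 : t != 0 by near: t; exact: nbhs_dnbhs_neq.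
  rewrite mulrA divfK ?divff// subr_eq0 -(expR0 R).
  by apply: contra t0 => /eqP/expR_inj ->.
Unshelve. all: by end_near. Qed.

End PowerSeriesInverse.

(** * Generating series *)

Section FormalExponential.
Variable F : numFieldType.
Implicit Types (a b s t : F) (T : nat).

(* Truncations of [exp(aX)], [(exp(aX) - 1) / (aX)] and [sinh(sX) / (sX)]. *)
Definition expp T a : {poly F} := \poly_(i < T.+1) (a ^+ i / i`!%:R).

Definition expm1p T a : {poly F} := \poly_(i < T.+1) (a ^+ i / i.+1`!%:R).

Definition sinhcp T s : {poly F} :=
  \poly_(i < T.+1) ((s ^+ i.+1 - (- s) ^+ i.+1) / (2 * s * i.+1`!%:R)).

Let fact_neq0 i : i`!%:R != 0 :> F.
Proof. by rewrite pnatr_eq0 -lt0n fact_gt0. Qed.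

Lemma exppD T a b : congX T (expp T a * expp T b) (expp T (a + b)).
Proof.
move=> i iT; rewrite coefM coef_poly ltnS iT addrC exprDn mulr_suml.
apply: eq_bigr => -[j /= ji] _; rewrite ltnS in ji.
rewrite !coef_poly !ltnS (leq_trans ji iT) (leq_trans (leq_subr _ _) iT).
have := bin_fact ji => /(congr1 (fun k => k%:R : F)).
rewrite !natrM => <-; rewrite -mulr_natr; field.
by rewrite !fact_neq0 pnatr_eq0 -lt0n bin_gt0 ji.
Qed.

Lemma expp0 T : congX T (expp T 0) 1.
Proof.
move=> i iT; rewrite coef_poly ltnS iT coef1 expr0n.
by case: i {iT} => [|i]; rewrite ?fact0 ?divr1 ?mul0r.
Qed.

Lemma expp_sum T n (a : 'I_n -> F) :
  congX T (\prod_(j < n) expp T (a j)) (expp T (\sum_(j < n) a j)).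
Proof.
apply: (big_ind2 (fun p x => congX T p (expp T x))) => //.
- by apply: congX_sym; exact: expp0.
- move=> p x q y px qy; apply: congX_trans (@exppD T x y).
  exact: congXM.
Qed.

(* [e^s (e^s - e^-s) / (2 s) = (e^(2 s) - 1) / (2 s)] *)
Lemma expp_sinhcp T s : s != 0 ->
  congX T (expp T s * sinhcp T s) (expm1p T (2 * s)).
Proof.
move=> s0; have s20 : 2 * s != 0 by rewrite mulf_neq0 ?pnatr_eq0.
(* The exponentials are cut one degree further because the factor X shifts the coefficients by one;
   the result is then compared in degree i + 1. *)
have sX : (2 * s) *: ('X * sinhcp T s) = expp T.+1 s - expp T.+1 (- s).
  apply/polyP => -[|i].
    by rewrite coefZ coefXM/= coefB !coef_poly/= !expr0 subrr mulr0.
  rewrite coefZ coefXM/= coefB !coef_poly !ltnS.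
  case: ifP => _; last by rewrite mulr0 subrr.
  by field; rewrite fact_neq0 s0.
have eT : congX T (expp T s) (expp T.+1 s).
  by move=> i iT; rewrite !coef_poly !ltnS iT (leq_trans iT).
apply: (@congX_trans _ _ _ (expp T.+1 s * sinhcp T s)); first exact: congXM.
move=> i iT; apply: (mulfI s20).
have -> : 2 * s * (expp T.+1 s * sinhcp T s)`_i =
    (expp T.+1 s * ((2 * s) *: ('X * sinhcp T s)))`_i.+1.
  by rewrite -scalerAr mulrCA coefZ coefXM.
have iT1 : (i.+1 <= T.+1)%N by [].
rewrite sX mulrBr coefB !exppD// addrN expp0// coef1 subr0.
rewrite !coef_poly !ltnS iT mulr2n mulrDl mul1r exprS; field.
exact: fact_neq0.
Qed.

End FormalExponential.

(** Distributing the product amounts to choosing one exponent p_j in each factor; this is where the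
    sum over finite functions in the final formula comes from. *)
Lemma coef_prod_poly (A : comNzRingType) m T (c : 'I_m -> nat -> A) d :
  (\prod_(j < m) \poly_(r < T.+1) c j r)`_d =
  \sum_(p : {ffun 'I_m -> 'I_T.+1} | (\sum_(j < m) p j)%N == d)
    \prod_(j < m) c j (p j).
Proof.
under eq_bigr do rewrite poly_def.
rewrite bigA_distr_bigA coef_sum [RHS]big_mkcond; apply: eq_bigr => p _.
transitivity (((\prod_(j < m) c j (p j)) *: 'X^(\sum_(j < m) p j)%N : {poly A})`_d).
  congr (nth _ (polyseq _) _); rewrite -mul_polyC.
  rewrite (big_morph _ (@polyCM _) (polyC1 _)).
  rewrite (big_morph _ (@exprD _ 'X) (expr0 _)) -big_split/=.
  by apply: eq_bigr => j _; rewrite mul_polyC.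
by rewrite coefZ coefXn eq_sym; case: eqP; rewrite ?mulr1 ?mulr0.
Qed.

Lemma rmorph_hsum (R S : comNzRingType) (f : {rmorphism R -> S})
    (a : nat -> R) u n l :
  hsum (f \o a) u n l = f (hsum a u n l).
Proof.
elim: n l => [|n IHn] l /=; first by rewrite rmorph1.
by rewrite rmorph_sum; apply: eq_bigr => k _; rewrite rmorphM IHn.
Qed.

(** * Passage to the limit and evaluation of the coefficients *)

Section Main.
Variable R : realType.
Local Notation C := R[i].

Lemma cexp_cis (x : R) : cexp ('i%C * x%:C) = cis x.
Proof.
rewrite (_ : 'i%C * x%:C = 0 +i* x); last first.
  by apply/eqP; rewrite eq_complex/= !mul0r !mul1r subr0 add0r !eqxx.
by rewrite /cexp expR0 mul1r.
Qed.

Definition sqcot K (k : nat) : R :=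
  (pi / K.*2.+1%:R * cotg (pi / K.*2.+1%:R * k%:R)) ^+ 2.

(** Finite counterpart, for N = 2K + 1, of sin(pi X) / (pi X) = sinh(i pi X) / (i pi X). *)
Definition sinepoly K : {poly C} :=
  \prod_(1 <= k < K.+1) (1 - (sqcot K k)%:C *: 'X^2).

(** Read off from the coefficient of X^(r+1) in [finite_sine_prod] at t = pi / N, where the leading
    factor 2iNt is 2i pi. Only the binomial quotient depends on K. *)
Lemma sinepoly_coef K r : (sinepoly K)`_r =
  (('i%C * (pi : R)%:C) ^+ r.+1 - (- ('i%C * (pi : R)%:C)) ^+ r.+1) /
    (2 * ('i%C * (pi : R)%:C)) *
  ('C(K.*2.+1, r.+1)%:R / K.*2.+1%:R ^+ r.+1)%:C.
Proof.
set N := K.*2.+1; have N0 : N%:R != 0 :> R by rewrite pnatr_eq0.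
have pi0 : (pi : R) != 0 by rewrite gt_eqF// pi_gt0.
have s0 : 2 * ('i%C * (pi : R)%:C) != 0.
  rewrite !mulf_neq0 ?pnatr_eq0 ?fmorph_eq0//.
  by rewrite eq_complex/= oner_eq0 andbF.
have := congr1 (fun p : {poly C} => p`_r.+1) (finite_sine_prod K (pi / N%:R)).
rewrite -/N.
rewrite -scaleNr coefB !coef_1DZX_exp coefZ coefXM/= mulrCA divff// mulr1.
rewrite -[2 * _ * _]mulrA => h; apply: (mulfI s0); rewrite -[LHS]h.
rewrite [RHS]mulrA [in RHS]mulrCA divff// mulr1 rmorphM !rmorphM/=.
rewrite (mulrA 'i%C) -mulNr !exprMn -mulrnBl -mulrBl -[LHS]mulr_natr -mulrA.
by congr (_ * _); rewrite mulrC rmorph_nat -exprVn rmorphXn.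
Qed.

Lemma ccvg_sinepoly T r : (r <= T)%N ->
  ccvg (fun K => (sinepoly K)`_r) (sinhcp T ('i%C * (pi : R)%:C))`_r.
Proof.
move=> rT; under eq_fun do rewrite sinepoly_coef.
rewrite coef_poly ltnS rT [X in ccvg _ (_ * X)]invfM [X in ccvg _ X]mulrA.
apply: ccvgM; first exact: ccvg_cst.
rewrite -(rmorph_nat (real_complex R)) -fmorphV; apply: ccvg_real.
exact: (cvg_comp _ _ cvg_odd (@cvg_bin_expn R r.+1)).
Qed.

(** For k <= K the angle k pi / N lies in ]0, pi/2], where the cotangent is nonnegative, so the
    bound x cot x <= 1 may be squared. *)
Lemma sqcot_le K k : (0 < k < K.+1)%N -> sqcot K k <= k%:R ^- 2.
Proof.
case/andP=> k0 kK; have kR : 0 < k%:R :> R by rewrite ltr0n.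
have NR : 0 < K.*2.+1%:R :> R by rewrite ltr0n.
have pi0 := @pi_gt0 R.
rewrite /sqcot -exprVn; set q := pi / _.
have q0 : 0 < q by rewrite divr_gt0.
have qk : q * k%:R <= pi / 2.
  rewrite /q mulrAC ler_pdivrMr// mulrAC -mulrA ler_pM2l//.
  rewrite ler_pdivlMr// -natrM ler_nat -addnn; lia.
have qk0 : 0 < q * k%:R by rewrite mulr_gt0.
have cg : 0 <= cotg (q * k%:R) by apply: cotg_ge0; rewrite qk0.
have qc : 0 <= q * cotg (q * k%:R) by exact: mulr_ge0 (ltW q0) cg.
rewrite ler_pXn2r// ?nnegrE ?invr_ge0 ?ler0n//.
rewrite -div1r ler_pdivlMr// mulrAC; apply: mul_cotg_le1.
by rewrite qk0/=; lra.
Qed.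

(** With x = k pi / N, which tends to 0, (pi / N) cot x is (x cot x) / k. *)
Lemma cvg_sqcot k : (0 < k)%N -> sqcot K k @[K --> \oo] --> (k%:R ^- 2 : R).
Proof.
move=> k0; have kR : k%:R != 0 :> R by rewrite pnatr_eq0 -lt0n.
pose x K : R := pi / K.*2.+1%:R * k%:R.
have x0 K : x K != 0.
  by rewrite !mulf_neq0 ?invr_eq0 ?pnatr_eq0// gt_eqF// pi_gt0.
have cx : x @ \oo --> 0.
  have -> : 0 = pi * 0 * k%:R :> R by rewrite mulr0 mul0r.
  apply: cvgM; last exact: cvg_cst.
  apply: cvgM; first exact: cvg_cst.
  exact: (cvg_comp _ _ cvg_odd (@cvg_invn R)).
have h := cvg_mul_cotg x0 cx.
have -> : (fun K => sqcot K k) =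
    (fun K => (k%:R^-1 * (x K * cotg (x K))) * (k%:R^-1 * (x K * cotg (x K)))).
  apply/funext => K; rewrite /sqcot -/(x K) expr2.
  have -> : k%:R^-1 * (x K * cotg (x K)) = pi / K.*2.+1%:R * cotg (x K).
    by rewrite {1}/x mulrA [k%:R^-1 * _]mulrC mulfK.
  by [].
rewrite -exprVn expr2.
have h1 : k%:R^-1 * (x K * cotg (x K)) @[K --> \oo] --> (k%:R^-1 * 1 : R).
  by apply: cvgM => //; exact: cvg_cst.
by rewrite mulr1 in h1; apply: cvgM.
Qed.

(** For Bernoulli numbers B, the coefficient of X^(2mn) in the product of the t_j / (exp(t_j) - 1)
    with t_j = 2i pi w^j X and w = exp(2i pi / m). Cutting each factor at degree 2mn leaves it
    unchanged. *)
Definition zeta_coef (B : nat -> R) m n : C :=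
  (\prod_(j < m) \poly_(r < (2 * m * n).+1) ((B r / r`!%:R)%:C *
      (2 * ('i%C * (pi : R)%:C * cis (2 * pi / m%:R) ^+ j)) ^+ r))`_(2 * m * n).

(** The generating series [G K] is inverse to [D K] modulo X^(T+1). The coefficients of [D K] tend
    to those of the product of the sinh(s_j X) / (s_j X), whose inverse is the Bernoulli product,
    and [ccvg_coef_inv] concludes. *)
Lemma ccvg_hsum_sqcot (B : nat -> R) m n : is_bernoulli B ->
  odd m -> (1 < m)%N ->
  ccvg (fun K => (hsum (fun k => sqcot K k ^+ m) K.+1 n 1)%:C)
       (zeta_coef B m n).
Proof.
move=> hB om m1; set T := (2 * m * n)%N; have m0 : (0 < m)%N by exact: ltnW.
pose w : C := cis (2 * pi / m%:R).
have pw : m.-primitive_root w by exact: cis_prim_root.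
have w0 : w != 0.
  apply/eqP => w0; have := prim_expr_order pw.
  by rewrite w0 expr0n gtn_eqF// => /eqP; rewrite eq_sym oner_eq0.
have w1 : w != 1.
  apply/eqP => w1; have := prim_order_dvd pw 1.
  by rewrite w1 expr1 eqxx dvdn1 gtn_eqF.
pose s (j : 'I_m) : C := 'i%C * (pi : R)%:C * w ^+ j.
have ipi0 : 'i%C * (pi : R)%:C != 0 :> C.
  have pi0 : (pi : R) != 0 by rewrite gt_eqF// pi_gt0.
  by rewrite mulf_neq0 ?fmorph_eq0// eq_complex/= oner_eq0 andbF.
have s0 j : s j != 0 by rewrite mulf_neq0 ?expf_neq0.
(* A geometric sum with w^m = 1 and w != 1. *)
have sum_s : \sum_(j < m) s j = 0.
  rewrite -mulr_sumr (_ : \sum_(j < m) w ^+ j = 0) ?mulr0//.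
  have := subrX1 w m; rewrite prim_expr_order// subrr => /esym/eqP.
  by rewrite mulf_eq0 subr_eq0 (negPf w1) => /eqP.
pose bp (j : 'I_m) : {poly C} :=
  \poly_(r < T.+1) ((B r / r`!%:R)%:C * (2 * s j) ^+ r).
pose G K : {poly C} := \sum_(r < T.+1)
  hsum (fun k => (sqcot K k)%:C ^+ m) K.+1 r 1 *: 'X^(2 * m * r).
pose D K : {poly C} := \prod_(j < m) (sinepoly K \Po (w ^+ j *: 'X)).
have DE K : D K = \prod_(1 <= k < K.+1) (1 - (sqcot K k)%:C ^+ m *: 'X^(2 * m)).
  exact: prod_comp_prim_root.
(* The term of index r sits in degree 2mr and T = 2mn, so only r = n contributes. *)
have GT K : (G K)`_T = (hsum (fun k => sqcot K k ^+ m) K.+1 n 1)%:C.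
  have nT : (n < T.+1)%N by rewrite ltnS /T leq_pmull// muln_gt0.
  rewrite coef_sum (bigD1 (Ordinal nT))//= coefZ coefXn eqxx mulr1.
  rewrite big1 ?addr0 => [|j jn]; last first.
    rewrite coefZ coefXn eqn_pmul2l ?muln_gt0//.
    by move: jn; rewrite -val_eqE/= eq_sym => /negPf->; rewrite mulr0.
  rewrite -(rmorph_hsum (real_complex R)); congr (hsum _ _ _ _).
  by apply/funext => k; exact/esym/(rmorphXn (real_complex R)).
under eq_fun do rewrite -GT.
rewrite /zeta_coef -/w -/T.
apply: (@ccvg_coef_inv R G D (\prod_(j < m) bp j)
  (\prod_(j < m) sinhcp T (s j)) T) => //.
- move=> K; rewrite DE -horner_coef0 horner_prod big1// => k _.
  by rewrite !hornerE expr0n gtn_eqF ?muln_gt0//= mulr0 subr0.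
- rewrite -horner_coef0 horner_prod big1// => j _.
  by rewrite horner_coef0 coef_poly/= !expr1 (factS 0) fact0; field; exact: s0.
- by move=> K; rewrite DE; apply: hsum_gen => //; rewrite muln_gt0.
- have h (j : 'I_m) : congX T (bp j * (expp T (s j) * sinhcp T (s j))) 1.
    apply: (@congX_trans _ _ _ (bp j * expm1p T (2 * s j))).
      by apply: congXM => //; exact: expp_sinhcp.
    (* The real identity [bernoulli_poly_inv] is transported to the complex numbers with X replaced
       by 2 s_j X. *)
    have -> : bp j * expm1p T (2 * s j) =
      (map_poly (real_complex R) ((\poly_(i < T.+1) (B i / i`!%:R)) *
        \poly_(i < T.+1) (i.+1`!%:R)^-1)) \Po ((2 * s j) *: 'X).
      rewrite rmorphM/= comp_polyM; congr (_ * _); apply/polyP => i.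
        rewrite coef_comp_ZX coef_map !coef_poly.
        by case: ifP => _; rewrite ?rmorph0 ?mul0r.
      rewrite coef_comp_ZX coef_map !coef_poly.
      case: ifP => _; rewrite ?rmorph0 ?mul0r//.
      by rewrite /= fmorphV rmorph_nat mulrC.
    move=> i iT; rewrite coef_comp_ZX coef_map/= bernoulli_poly_inv// !coef1.
    by case: i {iT} => [|i]; rewrite ?rmorph1 ?mulr1 ?rmorph0 ?mul0r.
  (* In the product over j the exponentials combine into exp(0) = 1, since the s_j sum to 0. *)
  have := congX_prod (index_enum 'I_m) h; rewrite big1_eq.
  rewrite !big_split/= => hp.
  apply: congX_trans hp; apply: congXM => //; rewrite -[X in congX _ X]mul1r.
  apply: congXM => //; apply: congX_sym.
  apply: congX_trans (@expp_sum _ _ _ _) _; rewrite sum_s; exact: expp0.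
- apply: ccvg_coef_prod => j i iT.
  under eq_fun do rewrite coef_comp_ZX.
  (* Replacing X by w^j X in sinh(i pi X) / (i pi X) gives the factor attached to s_j. *)
  have -> : (sinhcp T (s j))`_i = (sinhcp T ('i%C * (pi : R)%:C))`_i * (w ^+ j) ^+ i.
    rewrite !coef_poly ltnS iT /s; set x := 'i%C * _; set y := w ^+ j.
    have y0 : y != 0 by rewrite expf_neq0.
    rewrite -mulNr !exprMn !(exprSr y); field.
    by rewrite ipi0 y0 !pnatr_eq0 -lt0n fact_gt0.
  by apply: ccvgM; [exact: ccvg_sinepoly|exact: ccvg_cst].
Qed.

(** The powers (2i pi)^(p_j) multiply to (2i pi)^(2mn) because the p_j sum to 2mn, and the w^(j p_j)
    multiply to a single exponential. *)
Lemma zeta_coefE (B : nat -> R) m n : (0 < m)%N ->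
  zeta_coef B m n =
    (2 * (pi : R)%:C * 'i%C) ^+ (2 * m * n) *
    \sum_(p : {ffun 'I_m -> 'I_(2 * m * n).+1}
            | (\sum_(j < m) p j)%N == (2 * m * n)%N)
       (\prod_(j < m) (B (p j) / (p j)`!%:R)%:C) *
       cexp (2 * (pi : R)%:C * 'i%C / m%:R * (\sum_(l < m) l * p l)%N%:R).
Proof.
move=> m0; rewrite /zeta_coef coef_prod_poly mulr_sumr.
apply: eq_bigr => p /eqP pT.
rewrite big_split/= mulrCA; congr (_ * _).
have -> : 2 * (pi : R)%:C * 'i%C / m%:R * (\sum_(l < m) l * p l)%N%:R =
    'i%C * (2 * pi / m%:R * (\sum_(l < m) l * p l)%N%:R)%:C :> C.
  rewrite !rmorphM/= fmorphV !rmorph_nat; ring.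
have expr_sum (x : C) (f : 'I_m -> nat) :
    x ^+ (\sum_(j < m) f j)%N = \prod_(j < m) x ^+ f j.
  exact: (big_morph _ (@exprD _ x) (expr0 _)).
have -> : (2 * (pi : R)%:C * 'i%C) ^+ (2 * m * n) =
    \prod_(j < m) (2 * (pi : R)%:C * 'i%C) ^+ p j by rewrite -expr_sum pT.
rewrite cexp_cis -cisX expr_sum -big_split/=; apply: eq_bigr => j _.
by rewrite exprM -exprMn; congr (_ ^+ _); ring.
Qed.

Lemma zeta_starE (s n : nat) : zeta_star R s n =
  \esum_(k in [set k : n.-tuple nat | path leq 1 k])
    (\prod_(j <- k) (j%:R ^- s : R))%:E.
Proof.
by apply: eq_esum => k _; rewrite prodfV prodrXl.
Qed.

(** Two-sided comparison with the limit z. For fixed u, letting K grow in hsum (a K) u <= hsum (a K)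
    (K+1) bounds all partial sums of zeta-star by Re z, which gives finiteness. Conversely hsum (a
    K) (K+1) <= hsum b (K+1) is at most zeta-star. *)
Lemma zeta_star_eq (B : nat -> R) m n : is_bernoulli B ->
  odd m -> (1 < m)%N ->
  zeta_star R (2 * m) n \is a fin_num /\
  (fine (zeta_star R (2 * m) n))%:C = zeta_coef B m n.
Proof.
move=> hB om m1; have [] := ccvg_hsum_sqcot n hB om m1.
set z := zeta_coef B m n => hRe hIm.
have Imz : Im z = 0.
  have h0 : (0 : R) @[K --> \oo] --> 0 by exact: cvg_cst.
  exact: (cvg_unique _ hIm h0).
pose a K k : R := sqcot K k ^+ m.
pose b k : R := k%:R ^- (2 * m).
have a0 K k : 0 <= a K k by rewrite exprn_ge0// sqr_ge0.
have b0 k : 0 <= b k by rewrite invr_ge0 exprn_ge0.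
have cab k : (0 < k)%N -> a K k @[K --> \oo] --> b k.
  move=> k0; rewrite /b exprM -exprVn.
  apply: (@continuous_cvg _ _ _ _ _ (fun K => sqcot K k) (fun x => x ^+ m)).
    exact: exprn_continuous.
  exact: cvg_sqcot.
have le_lim u : hsum b u n 1 <= Re z.
  apply: (@ler_cvg_to _ \oo _ _ (fun K => hsum (a K) u n 1)
    (fun K => hsum (a K) K.+1 n 1)).
  - exact: cvg_hsum.
  - exact: hRe.
  - near=> K; apply: hsum_homo => //; apply: leqW.
    by near: K; exact: nbhs_infty_ge.
have zle : (zeta_star R (2 * m) n <= (Re z)%:E)%E.
  by rewrite zeta_starE; exact: esum_le_hsum.
have leb K : hsum (a K) K.+1 n 1 <= hsum b K.+1 n 1.
  apply: hsum_le => // k kK; rewrite /a /b exprM -exprVn.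
  by rewrite ler_pXn2r ?nnegrE ?sqr_ge0 ?invr_ge0 ?exprn_ge0 ?sqcot_le// ltnW.
have zfin : zeta_star R (2 * m) n \is a fin_num.
  rewrite fin_numE; apply/andP; split; apply/eqP => e.
    have : (0 <= zeta_star R (2 * m) n)%E.
      by rewrite zeta_starE; apply: esum_ge0 => k _; rewrite lee_fin prodr_ge0.
    by rewrite e.
  by move: zle; rewrite e.
split => //; apply/eqP; rewrite eq_complex/= Imz eqxx andbT eq_le.
rewrite -lee_fin fineK// zle/=.
apply: (@ler_cvg_to _ \oo _ _ (fun K => hsum (a K) K.+1 n 1)
    (fun=> fine (zeta_star R (2 * m) n))).
- exact: hRe.
- exact: cvg_cst.
- apply: nearW => K; apply: le_trans (leb K) _.
  rewrite -lee_fin fineK// zeta_starE.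
  exact: hsum_le_esum.
Unshelve. all: by end_near. Qed.

End Main.

Theorem theorem4 (R : realType) (B : nat -> R) (hB : is_bernoulli B)
    (m n : nat) (hm_odd : odd m) (hm : (3 <= m)%N) (hn : (0 < n)%N) :
  zeta_star R (2 * m) n \is a fin_num /\
  (fine (zeta_star R (2 * m) n))%:C =
    (2 * (pi : R)%:C * 'i%C) ^+ (2 * m * n) *
    \sum_(p : {ffun 'I_m -> 'I_(2 * m * n).+1}
            | (\sum_(j < m) p j)%N == (2 * m * n)%N)
       (\prod_(j < m) (B (p j) / (p j)`!%:R)%:C) *
       cexp (2 * (pi : R)%:C * 'i%C / m%:R * (\sum_(l < m) l * p l)%N%:R).
Proof.
have m1 : (1 < m)%N by exact: ltnW.
have [zfin ->] := zeta_star_eq n hB hm_odd m1.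
by split => //; rewrite zeta_coefE// ltnW.
Qed.
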